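(* Let $G=(V,E)$ be a graph and $\ell\ge 0$ an integer. If there exist two disjoint subsets $A,B\subseteq V$ with $|B|=2^{|A|}$ which are $\ell$-disconnectable, then the distance VC-dimension of $G$ is at least $|A|$.
   Context: All graphs are finite and simple; $d_H$ denotes shortest-path distance in a graph $H$ ($+\infty$ if no path), $B_H(x,k)=\{y:d_H(x,y)\le k\}$. For disjoint $A,B\subseteq V$, a family $\mathcal{S}=(S_{a,b})_{(a,b)\in A\times B}$ of vertex sets, each disjoint from $A\cup B$, is $\ell$-disconnecting for $A,B$ if for every subset $C\subseteq A\times B$ and every pair $(a,b)\in A\times B$, we have $d_{G'}(a,b)>\ell$ in the graph $G'=G\setminus\bigcup_{(a',b')\in C}S_{a',b'}$ if and only if $(a,b)\in C$. The pair $A,B$ is $\ell$-disconnectable if such a family exists. The $B$-hypergraph of a graph $H$ has vertex set $V(H)$ and hyperedges all balls $B_H(v,k)$, $v\in V(H)$, $k\ge0$. A set $X$ is shattered by a hypergraph if for every $X'\subseteq X$ some hyperedge $e$ satisfies $e\cap X=X'$; the VC-dimension is the maximum size of a shattered set. The distance VC-dimension of $G$ is the maximum over induced subgraphs $G'$ of $G$ of the VC-dimension of the $B$-hypergraph of $G'$. *)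

(* Defs.v *)
(* boolp is used only to decide two existential propositions over nat: the
   existence of a path of some length and of a radius giving a ball. *)
From HB Require Import structures.
From mathcomp Require Import all_boot.
From mathcomp Require Import boolp.

Set Implicit Arguments.
Unset Strict Implicit.
Unset Printing Implicit Defensive.

Record sgraph := SGraph {
  vertex :> finType;
  adj : rel vertex;
  adj_sym : symmetric adj;
  adj_irr : irreflexive adj }.

Section Induced.
Variables (G : sgraph) (W : {set G}).

Definition induced_adj : rel {x : G | x \in W} :=
  fun x y => adj (val x) (val y).

Lemma induced_adj_sym : symmetric induced_adj.
Proof. by move=> x y; apply: adj_sym. Qed.

Lemma induced_adj_irr : irreflexive induced_adj.
Proof. by move=> x; apply: adj_irr. Qed.

Definition induced : sgraph := SGraph induced_adj_sym induced_adj_irr.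

End Induced.

Definition delete (G : sgraph) (X : {set G}) : sgraph := induced (~: X).

Definition has_path (G : sgraph) (x y : G) (k : nat) : bool :=
  [exists p : k.-tuple G,
     [&& path (@adj G) x p, uniq (x :: p) & last x p == y]].

(* [None] stands for +oo. *)
Definition dist (G : sgraph) (x y : G) : option nat :=
  match pselect (exists k, has_path x y k) with
  | left ex_path => Some (ex_minn ex_path)
  | right _ => None
  end.

Definition dist_le (d : option nat) (k : nat) : bool :=
  if d is Some n then n <= k else false.

Definition dist_gt (d : option nat) (k : nat) : bool :=
  if d is Some n then k < n else true.

Definition ball (G : sgraph) (x : G) (k : nat) : {set G} :=
  [set y | dist_le (dist x y) k].

Definition ball_hypergraph (G : sgraph) : {set {set G}} :=
  [set e : {set G} | `[< exists (v : G) (k : nat), e = ball v k >]].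

(* A hypergraph on the vertex type [V] is given by its set of hyperedges. *)
Definition shattered (V : finType) (E : {set {set V}}) (X : {set V}) : bool :=
  [forall X' : {set V}, (X' \subset X) ==> [exists e in E, e :&: X == X']].

(* This is 0 when [E] is empty, in which case no set is shattered. *)
Definition vc_dim (V : finType) (E : {set {set V}}) : nat :=
  \max_(X : {set V} | shattered E X) #|X|.

Definition distance_vc_dim (G : sgraph) : nat :=
  \max_(W : {set G}) vc_dim (ball_hypergraph (induced W)).

(* The family is indexed by all pairs of vertices, but only its values on
   A x B matter.  The vertices of [delete X] form a subtype of those of [G];
   since the removed sets avoid A and B, every pair of A x B is of the form
   [(val a, val b)] with [a] and [b] in [delete X]. *)
Definition disconnecting (G : sgraph) (l : nat) (A B : {set G})
    (S : G * G -> {set G}) : Prop :=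
  (forall a b, a \in A -> b \in B -> [disjoint S (a, b) & A :|: B]) /\
  (forall C : {set G * G}, C \subset setX A B ->
   forall a b : delete (\bigcup_(c in C) S c), val a \in A -> val b \in B ->
     dist_gt (dist a b) l <-> (val a, val b) \in C).

Definition disconnectable (G : sgraph) (l : nat) (A B : {set G}) : Prop :=
  exists S : G * G -> {set G}, disconnecting l A B S.

(* Main.v *)
(* Choose f mapping B onto the powerset of A and delete S (a, b) for every pair
   with a \notin f b.  In the remaining graph the ball of radius l around b meets
   A exactly in f b, so these balls shatter A. *)
Require Import Defs.
From mathcomp Require Import boolp.
From mathcomp Require Import all_boot.

Set Implicit Arguments.
Unset Strict Implicit.
Unset Printing Implicit Defensive.

(** Matching the enumerations of [A] and [D] position by position gives [f]; [u0] is its value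
    outside [A]. It serves to index the subsets of a set by the elements of another. *)
Lemma eq_card_imset (T U : finType) (u0 : U) (A : {set T}) (D : {set U}) :
  #|A| = #|D| -> exists f : T -> U, f @: A = D.
Proof.
move=> eqAD; exists (fun x => nth u0 (enum D) (index x (enum A))).
apply/setP=> u; apply/imsetP/idP => [[x xA ->] | uD].
  by rewrite -mem_enum mem_nth // -cardE -eqAD cardE index_mem mem_enum.
have ltuA : index u (enum D) < size (enum A).
  by rewrite -cardE eqAD cardE index_mem mem_enum.
have [x0 _] : exists x0 : T, x0 \in enum A.
  by case: (enum A) ltuA => // x s _; exists x; rewrite mem_head.
exists (nth x0 (enum A) (index u (enum D))).
  by rewrite -mem_enum mem_nth.
by rewrite index_uniq ?enum_uniq // nth_index // mem_enum.
Qed.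

Lemma has_path_sym (G : sgraph) (x y : G) k : has_path x y k -> has_path y x k.
Proof.
case/existsP=> p /and3P[pp up /eqP lp].
(* Since [y] is the last vertex, [x :: p] reversed is [y :: rev (belast x p)]. *)
have sz : size (rev (belast x p)) == k by rewrite size_rev size_belast size_tuple.
apply/existsP; exists (Tuple sz); apply/and3P; split=> /=.
- rewrite -lp rev_path (eq_path (e' := @adj G)) // => u v.
  exact: adj_sym.
- by rewrite -[_ && _]/(uniq (y :: rev (belast x p))) -lp -rev_rcons -lastI
    rev_uniq.
- by rewrite -lp; case: (tval p) => //= z s; rewrite rev_cons last_rcons.
Qed.

(** The distance is the least path length, so a single path of length at most [k] already bounds it;
    infinite distance means no path at all. *)
Lemma dist_leP (G : sgraph) (x y : G) k :
  reflect (exists2 j, j <= k & has_path x y j) (dist_le (dist x y) k).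
Proof.
rewrite /dist; case: pselect => [ex | nex] /=.
  case: ex_minnP => m pm minm; apply: (iffP idP) => [lemk | [j lejk /minm]].
    by exists m.
  by move/leq_trans; apply.
by apply: ReflectF => -[j _ pj]; apply: nex; exists j.
Qed.

Lemma dist_le_sym (G : sgraph) (x y : G) k :
  dist_le (dist x y) k = dist_le (dist y x) k.
Proof.
by apply/dist_leP/dist_leP => -[j lejk /has_path_sym pj]; exists j.
Qed.

Lemma dist_gtN (d : option nat) k : dist_gt d k = ~~ dist_le d k.
Proof. by case: d => //= n; rewrite ltnNge. Qed.

Theorem theorem15 (G : sgraph) (l : nat) (A B : {set G}) :
  [disjoint A & B] -> #|B| = 2 ^ #|A| -> disconnectable l A B ->
  #|A| <= distance_vc_dim G.
Proof.
move=> _; rewrite -card_powerset => /(eq_card_imset set0)[f fB] [S [disjS discS]].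
pose C := [set c in setX A B | c.1 \notin f c.2].
have sCAB : C \subset setX A B by apply/subsetP=> c; rewrite inE => /andP[].
have {}discS := discS C sCAB.
set X := \bigcup_(c in C) S c in discS.
(* The sets in the union are indexed by pairs of [A] and [B], hence avoid both: every vertex of [A]
   and [B] survives the deletion. *)
have notX x : x \in A :|: B -> x \in ~: X.
  move=> xAB; rewrite inE; apply/bigcupP => -[[a b] /(subsetP sCAB)].
  by rewrite in_setX => /andP[aA bB] /(disjointFr (disjS a b aA bB)); rewrite xAB.
pose A' : {set delete X} := [set a | val a \in A].
have cardA' : #|A| = #|A'|.
  rewrite -(card_imset (mem A') val_inj); apply: eq_card => x.
  apply/idP/imsetP => [xA | [a + ->]]; last by rewrite inE.
  have xX : x \in ~: X by apply: notX; rewrite inE xA.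
  by exists (Sub x xX); rewrite // inE.
have shA' : shattered (ball_hypergraph (delete X)) A'.
  apply/forallP=> Y; apply/implyP=> sYA.
  (* Seen in [G], the trace [Y] is a subset of [A], hence some [f b]; this [b] is the centre of the
     ball. *)
  have : val @: Y \in f @: B.
    rewrite fB powersetE; apply/subsetP=> _ /imsetP[y yY ->].
    by have := subsetP sYA y yY; rewrite inE.
  case/imsetP=> b bB fb.
  have bX : b \in ~: X by apply: notX; rewrite inE bB orbT.
  pose b' : delete X := Sub b bX.
  apply/existsP; exists (ball b' l); apply/andP; split.
    by rewrite inE; apply/asboolP; exists b', l.
  apply/eqP/setP=> a; rewrite !inE.
  (* Outside [A] both sides are false, because [Y] lies in [A']. *)
  have [aA | aNA] := boolP (val a \in A); last first.
    by rewrite andbF; apply/esym/negP => /(subsetP sYA); rewrite inE (negPf aNA).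
  have -> : (a \in Y) = (val a \in f b) by rewrite -fb (mem_imset _ _ val_inj).
  have /(_ aA bB) gtP := discS a b'.
  (* The ball measures from [b'], while [discS] measures from [a]. Being outside the ball is then
     membership of the pair in [C], that is, [val a \notin f b]. *)
  rewrite andbT dist_le_sym; apply: negb_inj; rewrite -dist_gtN.
  by apply/idP/idP => [/gtP | aNf]; [|apply/gtP]; rewrite !inE /= aA bB.
(* Two nested maxima: [A'] is a candidate in the inner one, and [delete X], being induced on [~: X],
   in the outer one. *)
rewrite cardA'; apply: (@leq_trans (vc_dim (ball_hypergraph (delete X)))).
  exact: (leq_bigmax_cond (F := fun Z : {set delete X} => #|Z|) _ shA').
exact: (leq_bigmax (F := fun W => vc_dim (ball_hypergraph (induced W)))).
Qed.
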